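(* If $T$ is a caterpillar of order $n\ge 2$ with $\ell$ leaves and $$\ell\le\log_2\left(\frac{n}{3\log_2(n)+3}\right)=\log_2(n)-\log_2(\log_2(n)+1)-\log_2(3),$$ then $T$ is not optimal in $\mathcal{T}_n$ and $T$ is not optimal in $\mathcal{C}_n$.
   Context: The order of a graph is its number of vertices. A subtree of a tree $T$ is a nonempty connected subgraph. The mean subtree order $M_T$ is the average of the orders of all subtrees of $T$. A tree of maximum mean subtree order in a given family is called optimal in that family. $\mathcal{T}_n$ is the family of all trees of order $n$ and $\mathcal{C}_n$ is the family of all caterpillars of order $n$, where a caterpillar is a tree for which deleting all leaves leaves a path (possibly empty or a single vertex). *)

(* Defs.v *)
From HB Require Import structures.
From mathcomp Require Import all_boot all_order all_algebra.
From mathcomp Require Import reals exp.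

Set Implicit Arguments.
Unset Strict Implicit.
Unset Printing Implicit Defensive.

Import Order.TTheory GRing.Theory Num.Theory.

Record sgraph := SGraph {
  vertex :> finType;
  adj : rel vertex;
  adj_sym : symmetric adj;
  adj_irrefl : irreflexive adj }.

Section Graph.

Variable G : sgraph.

Definition edges : {set {set G}} :=
  [set f : {set G} | [exists x, exists y, adj x y && (f == [set x; y])]].

Definition connected_graph : Prop := forall x y : G, connect (@adj G) x y.

(* [ucycle e p] also holds for [::] and for [:: x; y] with x, y adjacent; the
   size condition leaves exactly the cycles of length at least 3. *)
Definition acyclic : Prop :=
  forall p : seq G, 2 < size p -> ~ ucycle (@adj G) p.

Definition is_tree : Prop := [/\ 0 < #|G|, connected_graph & acyclic].

Definition degree (x : G) : nat := #|[set y | adj x y]|.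

Definition leaves : {set G} := [set x | degree x == 1].

(* A subgraph is a pair (S, F) of a vertex set and a set of edges with both
   ends in S; it need not be induced. *)
Definition is_subgraph (H : {set G} * {set {set G}}) : bool :=
  (H.2 \subset edges) && [forall f in H.2, f \subset H.1].

Definition subgraph_adj (H : {set G} * {set {set G}}) : rel G :=
  [rel x y | [set x; y] \in H.2].

Definition subtrees : {set {set G} * {set {set G}}} :=
  [set H | [&& is_subgraph H, H.1 != set0 &
    [forall x in H.1, forall y in H.1, connect (subgraph_adj H) x y]]].

Definition mean_subtree_order : rat :=
  ((\sum_(H in subtrees) #|H.1|)%N%:R / #|subtrees|%:R)%R.

Definition induced_adj (S : {set G}) : rel {x : G | x \in S} :=
  fun u v => adj (val u) (val v).

Lemma induced_adj_sym (S : {set G}) : symmetric (@induced_adj S).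
Proof. by move=> u v; apply: adj_sym. Qed.

Lemma induced_adj_irrefl (S : {set G}) : irreflexive (@induced_adj S).
Proof. by move=> u; apply: adj_irrefl. Qed.

Definition induced (S : {set G}) : sgraph :=
  SGraph (@induced_adj_sym S) (@induced_adj_irrefl S).

(* Isomorphic to the path 0 - 1 - ... - (k - 1) for some k; k = 0 (empty graph)
   and k = 1 (single vertex) are allowed. *)
Definition is_path : Prop :=
  exists k (f : 'I_k -> G), bijective f /\
    forall i j : 'I_k, adj (f i) (f j) = (i.+1 == j :> nat) || (j.+1 == i :> nat).

End Graph.

Definition is_caterpillar (G : sgraph) : Prop :=
  is_tree G /\ is_path (induced (~: leaves G)).

Definition trees_of_order (n : nat) (G : sgraph) : Prop :=
  is_tree G /\ #|G| = n.

Definition caterpillars_of_order (n : nat) (G : sgraph) : Prop :=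
  is_caterpillar G /\ #|G| = n.

Definition optimal (family : sgraph -> Prop) (T : sgraph) : Prop :=
  family T /\
  forall T', family T' -> (mean_subtree_order T' <= mean_subtree_order T)%R.

Definition log2 (R : realType) (x : R) : R := (ln x / ln 2)%R.

(* Main.v *)
Require Import Defs.
From mathcomp Require Import all_boot all_order all_algebra zify lra.
From mathcomp Require Import reals exp.

(** Write n for the order of T and l for its number of leaves, and measure a
    tree of order n by its mean deficiency: the mean number of vertices that a
    subtree misses. Since the mean subtree order is n minus the mean deficiency
    ([mean_deficiency]), it is enough to find a caterpillar of order n with a
    smaller mean deficiency. With so few leaves, the mean deficiency of T is at
    least about 8 log2 n, whereas a path with many leaves glued to its two ends
    achieves about 6 log2 n.

    Lower bound for T ([spined_deficiency_gt]). Extend the path of non-leaves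
    by one leaf at each end to a path with s = n - l + 2 vertices, the spine;
    the other l - 2 leaves are the legs. A subtree meets the spine in an
    interval or not at all, and it is determined by this intersection and by
    its set of legs. So if P = s(s+1)/2 counts the intervals, T has at most
    (P + 1) 2^(l-2) subtrees. The intervals themselves are subtrees, of mean
    order (s+2)/3, and together they contribute P (n - (s+2)/3), about
    (2/3) n P or more, to the total deficiency. The mean deficiency is hence at
    least about (8/3) n / 2^l, and the hypothesis says that n / 2^l is at
    least 3 log2 n + 3.

    Upper bound for the competitor ([broom_deficiency_le]). Let k legs hang at
    each end of a path, with 2^k >= 2 n^3. The subtrees that contain the whole
    path miss at most 2k vertices each, and there are 4^k of them. Any other
    subtree has legs at one end only, so there are at most 2 2^k n^2 of these,
    and each misses at most n vertices: altogether they miss at most 4^k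
    vertices, that is one per subtree on average. The mean deficiency is at
    most 2k + 1. With L the integer part of log2 n one can take k = 3L + 4,
    which gives 6L + 9; this is small enough because the hypothesis forces
    L >= 6.

    Both trees are described by the same predicate [spined], so that the
    analysis of subtrees is done once and serves both bounds. *)

Import Order.TTheory GRing.Theory Num.Theory.
Local Open Scope ring_scope.

(** * Subtrees and deficiency *)

Section Graphs.
Local Open Scope nat_scope.
Context {G : sgraph}.
Implicit Types (x y z : G) (H : {set G} * {set {set G}}).

Lemma degree_gt1 {x y z} : adj x y -> adj x z -> y != z ->
  1 < degree x.
Proof.
move=> xy xz yz; rewrite /degree (cardD1 y) (cardD1 z) !inE xy xz eq_sym yz //.
Qed.

Lemma mem_edges x y : ([set x; y] \in edges G) = adj x y.
Proof.
rewrite inE; apply/existsP/idP => [[u /existsP[v /andP[uv /eqP e]]]|xy]; last first.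
  by exists x; apply/existsP; exists y; rewrite xy eqxx.
have uv' : u != v by apply: contraTneq uv => ->; rewrite adj_irrefl.
have : x \in [set u; v] by rewrite -e set21.
have : y \in [set u; v] by rewrite -e set22.
have : u \in [set x; y] by rewrite e set21.
have : v \in [set x; y] by rewrite e set22.
rewrite !inE.
move=> /orP[]/eqP ev /orP[]/eqP eu; subst u v; rewrite ?eqxx // in uv' *.
by rewrite adj_sym.
Qed.

Lemma subtree_edge {H x y} : H \in subtrees G -> [set x; y] \in H.2 ->
  [/\ adj x y, x \in H.1 & y \in H.1].
Proof.
rewrite inE => /and3P[/andP[/subsetP sE /forallP sV] _ _] xy.
split; first by rewrite -mem_edges; exact: sE.
  by have /implyP/(_ xy)/subsetP := sV [set x; y]; apply; rewrite set21.
by have /implyP/(_ xy)/subsetP := sV [set x; y]; apply; rewrite set22.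
Qed.

Lemma subtree_connect {H x y} : H \in subtrees G -> x \in H.1 -> y \in H.1 ->
  connect (subgraph_adj H) x y.
Proof.
rewrite inE => /and3P[_ _ /forallP h] xH yH.
by have /implyP/(_ xH)/forallP/(_ y)/implyP/(_ yH) := h x.
Qed.

Definition spanned (S : {set G}) : {set G} * {set {set G}} :=
  (S, [set f in edges G | f \subset S]).

Lemma spanned_subtree (S : {set G}) x : x \in S ->
  (forall y, y \in S -> connect (subgraph_adj (spanned S)) y x) ->
  spanned S \in subtrees G.
Proof.
move=> xS h; rewrite inE; apply/and3P; split.
- apply/andP; split; first by apply/subsetP => f; rewrite inE => /andP[].
  by apply/forallP=> f; apply/implyP; rewrite inE => /andP[].
- by apply/set0Pn; exists x.
have sy : connect_sym (subgraph_adj (spanned S)).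
  by apply: sym_connect_sym=> u v; rewrite /subgraph_adj /= setUC.
apply/forallP=> u; apply/implyP=> uS; apply/forallP=> v; apply/implyP=> vS.
by apply: connect_trans (h _ uS) _; rewrite sy; exact: h.
Qed.

(** In an acyclic graph a subtree is determined by its vertices: an edge of the
    graph between two of them that the subtree lacks would close a cycle with
    the path that joins them inside the subtree. *)
Lemma subtree_spanned H : acyclic G -> H \in subtrees G -> H = spanned H.1.
Proof.
move=> acG HT; case: H HT => S F HT; congr pair; apply/setP=> f.
apply/idP/idP.
  move=> fF; rewrite inE.
  move: HT; rewrite inE => /and3P[/andP[/subsetP sE /forallP sV] _ _].
  by rewrite sE //=; have /implyP/(_ fF) := sV f.
rewrite !inE => /andP[/existsP[x /existsP[y /andP[xy /eqP ->]]]].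
rewrite subUset !sub1set => /andP[xS yS].
apply: contraT => nF.
have /connectP[p pth yE] := @subtree_connect (S, F) x y HT xS yS.
case/shortenP: pth yE => p' pth up _ yE.
exfalso; apply: (acG (x :: p')).
  case: p' pth yE {up} => [|u [|v p']] //= pth yE.
    by move: xy; rewrite yE adj_irrefl.
    by move: pth nF; rewrite yE andbT /subgraph_adj /= => ->.
rewrite /ucycle up andbT /= rcons_path -yE adj_sym xy andbT.
by apply: sub_path pth => u v /(@subtree_edge (S, F) _ _ HT) [].
Qed.

(** Total number of vertices missed. Working with it rather than with the total
    order keeps both bounds independent of the leading term n. *)
Definition deficiency : nat := \sum_(H in subtrees G) (#|G| - #|H.1|).

End Graphs.
Arguments deficiency : clear implicits.

Lemma subtrees_gt0 (G : sgraph) : (0 < #|G|)%N -> (0 < #|subtrees G|)%N.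
Proof.
case/card_gt0P=> x _; apply/card_gt0P; exists (spanned [set x]).
apply: (@spanned_subtree _ _ x); first by rewrite set11.
by move=> y; rewrite inE => /eqP ->; exact: connect0.
Qed.

Lemma mean_deficiency (G : sgraph) : (0 < #|G|)%N ->
  mean_subtree_order G = #|G|%:R - (deficiency G)%:R / #|subtrees G|%:R.
Proof.
move=> G0; rewrite /mean_subtree_order.
have N0 : #|subtrees G|%:R != 0 :> rat.
  by rewrite pnatr_eq0 -lt0n subtrees_gt0.
have e : (\sum_(H in subtrees G) #|H.1| + deficiency G = #|G| * #|subtrees G|)%N.
  rewrite -big_split /= (eq_bigr (fun=> #|G|)) ?sum_nat_const 1?mulnC //.
  by move=> H _; rewrite subnKC // max_card.
apply: (canRL (addrK _)); rewrite -mulrDl -natrD e natrM mulfK //.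
Qed.

(** The integer K separates the two mean deficiencies, so that the comparison
    never involves a quotient. *)
Lemma mean_lt (G G' : sgraph) K : (0 < #|G|)%N -> #|G'| = #|G| ->
  (K * #|subtrees G| < deficiency G)%N ->
  (deficiency G' <= K * #|subtrees G'|)%N ->
  mean_subtree_order G < mean_subtree_order G'.
Proof.
move=> G0 e h h'; rewrite !mean_deficiency ?e //.
rewrite ltrD2l ltrN2; apply: (@le_lt_trans _ _ K%:R).
  by rewrite ler_pdivrMr ?ltr0n ?subtrees_gt0 ?e // -natrM ler_nat.
by rewrite ltr_pdivlMr ?ltr0n ?subtrees_gt0 // -natrM ltr_nat.
Qed.

(** * Caterpillars with a marked spine *)

Section Cycles.
Local Open Scope nat_scope.
Context {G : sgraph}.

(** In a cycle of length at least 3, the successor and the predecessor of a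
    vertex are different. *)
Lemma ucycle_neighbours {p : seq G} {x : G} : ucycle (@adj G) p -> 2 < size p ->
  x \in p ->
  exists y z, [/\ y \in p, z \in p, y != z, adj x y & adj x z].
Proof.
move=> /andP[cyc un] sz xp; case: (rot_to xp) => i p' e.
have mem_p w : (w \in p) = (w \in x :: p') by rewrite -e mem_rot.
move: cyc un sz; rewrite -(rot_cycle i) -(rot_uniq i) -(size_rot i) e.
case/lastP: p' {e} mem_p => [|p' z] //; case: p' => [|y p'] // mem_p cyc un _.
exists y, z; move: cyc un; rewrite /= rcons_path last_rcons.
move=> /and3P[xy _ zx] /and3P[_ yn _].
rewrite !mem_p !inE !mem_rcons !inE !eqxx !orbT; split=> //.
  by apply: contraNneq yn => ->; rewrite mem_rcons inE eqxx.
by rewrite adj_sym.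
Qed.

End Cycles.

(** A caterpillar drawn along a path: [spine] carries the coordinates
    0, ..., s - 1, and every other vertex is a leg, whose coordinate is that of
    the spine vertex it hangs from. The spine may be the path of non-leaves
    (as for the competitor below) or that path with a leaf added at each end
    (as for the given caterpillar). *)
Record spined (G : sgraph) (spine : {set G}) (pos : G -> nat) (s : nat) : Prop := {
  pos_lt : forall x, (pos x < s)%N;
  pos_inj : {in spine &, injective pos};
  pos_surj : forall i, (i < s)%N -> exists2 x, x \in spine & pos x = i;
  spined_adj : forall x y, adj x y =
    if x \in spine then
      if y \in spine then ((pos x).+1 == pos y) || ((pos y).+1 == pos x)
      else pos x == pos y
    else (y \in spine) && (pos x == pos y) }.

Section Spined.
Local Open Scope nat_scope.
Context {G : sgraph} {spine : {set G}} {pos : G -> nat} {s : nat}.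
Hypothesis sp : spined G spine pos s.
Implicit Types (x y z : G) (H : {set G} * {set {set G}}).

Lemma spined_foot x : exists2 y, y \in spine & pos y = pos x.
Proof. exact: (pos_surj _ _ _ _ sp) (pos_lt _ _ _ _ sp x). Qed.

Lemma leg_adj {x y} : x \notin spine -> adj x y -> y \in spine /\ pos y = pos x.
Proof.
by move=> xl; rewrite (spined_adj _ _ _ _ sp) (negPf xl) => /andP[? /eqP].
Qed.

Lemma adj_pos {x y} : adj x y -> pos y <= (pos x).+1.
Proof.
rewrite (spined_adj _ _ _ _ sp); case: ifP => _; last by case/andP => _ /eqP ->.
by case: ifP => _; [case/orP => /eqP|move/eqP]; lia.
Qed.

Definition block (a b : nat) (A : {set G}) : {set G} :=
  [set x | (a <= pos x <= b) && ((x \in spine) || (x \in A))].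

Lemma block_subtree {a b} (A : {set G}) : a <= b < s ->
  spanned (block a b A) \in subtrees G.
Proof.
move=> /andP[ab bs].
have [r rS ra] := pos_surj _ _ _ _ sp a (leq_ltn_trans ab bs).
have step x y : x \in block a b A -> y \in block a b A -> adj x y ->
    subgraph_adj (spanned (block a b A)) x y.
  move=> xB yB xy; rewrite /subgraph_adj /= inE mem_edges xy /=.
  by rewrite subUset !sub1set xB.
apply: (@spanned_subtree _ _ r); first by rewrite inE rS ra leqnn ab.
have spineC y : y \in spine -> a <= pos y <= b ->
    connect (subgraph_adj (spanned (block a b A))) y r.
  move: {2}(pos y) (erefl (pos y)) => i; elim: i y => [|i IH] y yi yS yab.
    rewrite (_ : y = r) ?connect0 //; apply: (pos_inj _ _ _ _ sp) => //; lia.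
  case: (eqVneq (pos y) a) => [ya|ya].
    by rewrite (_ : y = r) ?connect0 //; apply: (pos_inj _ _ _ _ sp) => //; lia.
  have [z zS zi] : exists2 z, z \in spine & pos z = i.
    by apply: (pos_surj _ _ _ _ sp); lia.
  apply: connect_trans (IH z zi zS _); last by lia.
  apply/connect1/step; rewrite ?inE ?zS ?yS ?orbT ?andbT //; first lia.
  by rewrite (spined_adj _ _ _ _ sp) yS zS zi yi eqxx orbT.
move=> y yB; move: (yB); rewrite inE => /andP[yab _].
case: (boolP (y \in spine)) => yS; first exact: spineC.
have [z zS zy] := spined_foot y.
apply: connect_trans (spineC z zS _); last by rewrite zy.
apply/connect1/step => //; first by rewrite inE zS zy yab.
by rewrite (spined_adj _ _ _ _ sp) (negPf yS) zS zy eqxx.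
Qed.

Lemma spined_connected : connected_graph G.
Proof.
move=> x y.
have s0 : 0 <= s.-1 < s by have := pos_lt _ _ _ _ sp x; lia.
have inB z : z \in (spanned (block 0 s.-1 setT)).1.
  by rewrite !inE orbT andbT; have := pos_lt _ _ _ _ sp z; lia.
have BT := block_subtree setT s0.
apply: connect_sub (subtree_connect BT (inB x) (inB y)) => u v uv.
by apply: connect1; case: (subtree_edge BT uv).
Qed.

(** A cycle avoids the legs, which have a single neighbour. Its vertex of
    largest coordinate then has both its cycle neighbours on the spine, at the
    preceding coordinate, so they coincide. *)
Lemma spined_acyclic : acyclic G.
Proof.
move=> p sz cyc.
have onS x : x \in p -> x \in spine.
  move=> xp; apply: contraT => xl.
  have [y [z [_ _ yz xy xz]]] := ucycle_neighbours cyc sz xp.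
  have [yS yx] := leg_adj xl xy; have [zS zx] := leg_adj xl xz.
  by case/eqP: yz; apply: (pos_inj _ _ _ _ sp) => //; rewrite yx.
have [x0 x0p] : exists x0, x0 \in p.
  by case: p sz {cyc onS} => [//|x p] _; exists x; rewrite mem_head.
have [x xp xmax] := @arg_maxnP _ x0 [in p] pos x0p.
have [y [z [yp zp yz xy xz]]] := ucycle_neighbours cyc sz xp.
case/eqP: yz; apply: (pos_inj _ _ _ _ sp); rewrite ?onS //.
have := xmax _ yp; have := xmax _ zp; move: xy xz.
by rewrite !(spined_adj _ _ _ _ sp) !onS // => /orP[]/eqP + /orP[]/eqP; lia.
Qed.

(** A subtree that is not a single leg contains the spine vertex below each of
    its legs, as a path leaving a leg starts there. *)
Lemma subtree_foot {H x y z} : H \in subtrees G -> x \in H.1 -> y \in H.1 ->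
  x != y -> z \in spine -> pos z = pos x -> z \in H.1.
Proof.
move=> HT xH yH xy zS zx; case: (boolP (x \in spine)) => xS.
  by rewrite (_ : z = x) //; apply: (pos_inj _ _ _ _ sp).
have /connectP[[|w p] /= pth yE] := subtree_connect HT xH yH.
  by rewrite yE eqxx in xy.
case/andP: pth => /(subtree_edge HT)[xw _ wH] _.
have [wS wx] := leg_adj xS xw.
by rewrite (_ : z = w) //; apply: (pos_inj _ _ _ _ sp) => //; rewrite wx.
Qed.

(** A discrete intermediate value theorem: the coordinate changes by at most one
    along an edge. *)
Lemma subtree_pos_interval {H x y i} : H \in subtrees G ->
  x \in H.1 -> y \in H.1 -> pos x <= i <= pos y ->
  exists2 w, w \in H.1 & pos w = i.
Proof.
move=> HT xH yH.
have /connectP[p] := subtree_connect HT xH yH.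
elim: p x xH => [|w p IH] x xH /= pth yE xiy.
  by exists x => //; rewrite yE in xiy; lia.
case: (eqVneq (pos x) i) => [|xi]; first by exists x.
case/andP: pth => /(subtree_edge HT)[xw _ wH] pth.
by apply: (IH w) => //; have := adj_pos xw; lia.
Qed.

(** The hypothesis that x and y differ excludes a single leg, whose coordinate
    is reached without its foot being in the subtree. *)
Lemma subtree_convex {H x y z} : H \in subtrees G -> x \in H.1 -> y \in H.1 ->
  x != y -> z \in spine -> pos x <= pos z <= pos y -> z \in H.1.
Proof.
move=> HT xH yH xy zS xzy.
have [w wH wz] := subtree_pos_interval HT xH yH xzy.
have [wx|wx] := eqVneq w x; last exact: (subtree_foot HT wH xH wx zS).
by apply: (subtree_foot HT wH yH) => //; rewrite wx.
Qed.

Lemma card_block a b : b < s -> #|block a b set0| = b.+1 - a.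
Proof.
move=> bs.
have memB x : (x \in enum (block a b set0)) =
    (a <= pos x <= b) && (x \in spine).
  by rewrite mem_enum !inE orbF.
have un : uniq (map pos (enum (block a b set0))).
  rewrite map_inj_in_uniq ?enum_uniq // => x y; rewrite !memB.
  by move=> /andP[_ xS] /andP[_ yS]; apply: (pos_inj _ _ _ _ sp).
rewrite cardE -(size_map pos) -(size_iota a (b.+1 - a)).
apply: perm_size; apply: uniq_perm; rewrite ?iota_uniq // => i.
rewrite mem_iota; apply/mapP/idP => [[x]|iab].
  by rewrite memB => /andP[? _] ->; lia.
have [x xS xi] : exists2 x, x \in spine & pos x = i.
  by apply: (pos_surj _ _ _ _ sp); lia.
by exists x => //; rewrite memB xS xi andbT; lia.
Qed.

Lemma card_spine : 0 < s -> #|spine| = s.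
Proof.
move=> s0; rewrite -[RHS]prednK // -[RHS]subn0 -card_block ?prednK //.
apply: eq_card => x; rewrite !inE orbF.
by case: (x \in spine); rewrite ?andbF ?andbT //; have := pos_lt _ _ _ _ sp x; lia.
Qed.

Definition intervals : {set 'I_s * 'I_s} := [set ab : 'I_s * 'I_s | ab.1 <= ab.2].

Definition interval_block (ab : 'I_s * 'I_s) : {set G} := block ab.1 ab.2 set0.

Lemma interval_block_inj : {in intervals &, injective interval_block}.
Proof.
have sub (u v : 'I_s * 'I_s) : u \in intervals ->
    interval_block u = interval_block v -> v.1 <= u.1 /\ u.2 <= v.2.
  case: u v => [a b] [c d]; rewrite inE /interval_block /= => ab e.
  have [x xS xa] := pos_surj _ _ _ _ sp a (ltn_ord a).
  have [y yS yb] := pos_surj _ _ _ _ sp b (ltn_ord b).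
  have : x \in block c d set0 by rewrite -e inE xS xa leqnn ab.
  have : y \in block c d set0 by rewrite -e inE yS yb leqnn ab.
  by rewrite !inE yb xa => /andP[/andP[_ ->] _] /andP[/andP[-> _] _].
move=> [a b] [c d] uI vI e.
have [/= h1 h2] := sub _ _ uI e; have [/= h3 h4] := sub _ _ vI (esym e).
by congr pair; apply: val_inj => /=; lia.
Qed.

(** The empty set is the trace of the subtrees that consist of a single leg. *)
Lemma subtree_cap_spine {H} : H \in subtrees G ->
  H.1 :&: spine \in set0 |: [set interval_block ab | ab in intervals].
Proof.
move=> HT; rewrite in_setU1; case: (set_0Vmem (H.1 :&: spine)) => [->|[x0 x0I]].
  by rewrite eqxx.
apply/orP; right.
have [x xI xmin] := @arg_minnP _ x0 [in H.1 :&: spine] pos x0I.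
have [y yI ymax] := @arg_maxnP _ x0 [in H.1 :&: spine] pos x0I.
apply/imsetP; exists (Ordinal (pos_lt _ _ _ _ sp x), Ordinal (pos_lt _ _ _ _ sp y)).
  by rewrite inE /=; exact: xmin.
apply/setP => z; rewrite !inE /= orbF.
have /setIP[xH xS] := xI; have /setIP[yH yS] := yI.
apply/andP/andP => [[zH zS]|[xzy zS]]; split=> //.
  have zI : z \in H.1 :&: spine by rewrite inE zH.
  by have := xmin _ zI; have := ymax _ zI; move=> /= -> ->.
have [exy|xy] := eqVneq x y; last exact: (subtree_convex HT xH yH xy).
rewrite (_ : z = x) //; apply: (pos_inj _ _ _ _ sp) => //.
by rewrite -exy in xzy; lia.
Qed.

(** A subtree is encoded by its trace on the spine and its set of legs. The
    subfamily P serves to bound the number of subtrees of the competitor that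
    do not contain the spine, whose sets of legs are restricted. *)
Lemma card_subtrees_le (P : {set {set G} * {set {set G}}}) (Q : {set {set G}}) :
  P \subset subtrees G -> (forall H, H \in P -> H.1 :\: spine \in Q) ->
  #|P| <= #|intervals|.+1 * #|Q|.
Proof.
move=> /subsetP PT PQ.
pose code H := (H.1 :&: spine, H.1 :\: spine).
have codeI : {in P &, injective code}.
  move=> H K HP KP [e1 e2].
  rewrite (subtree_spanned _ spined_acyclic (PT _ HP)).
  rewrite (subtree_spanned _ spined_acyclic (PT _ KP)).
  by rewrite -(setID H.1 spine) e1 e2 setID.
rewrite -(card_in_imset codeI).
pose I := [set interval_block ab | ab in intervals].
apply: (@leq_trans #|setX (set0 |: I) Q|).
  apply/subset_leq_card/subsetP => _ /imsetP[H HP ->].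
  by rewrite in_setX /code /= subtree_cap_spine ?PT //= PQ.
rewrite cardsX leq_mul2r cardsU1 -add1n; apply/orP; right.
by apply: leq_add; [case: (_ \notin _)|exact: leq_imset_card].
Qed.

(** Any set of legs can be added to the whole spine. *)
Lemma card_subtrees_ge : 0 < s -> 2 ^ #|~: spine| <= #|subtrees G|.
Proof.
move=> s0; rewrite -card_powerset.
pose F A := spanned (block 0 s.-1 A).
have FK (A : {set G}) : A \subset ~: spine -> (F A).1 :\: spine = A.
  move=> /subsetP AL; apply/setP => x; rewrite !inE.
  have -> : 0 <= pos x <= s.-1 by have := pos_lt _ _ _ _ sp x; lia.
  case: (boolP (x \in A)) => [/AL|]; last by rewrite orbF /= => _; case: (_ \in _).
  by rewrite inE => ->; rewrite orbT.
have FI : {in powerset (~: spine) &, injective F}.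
  by move=> A B; rewrite !powersetE => /FK AK /FK BK e; rewrite -AK e BK.
rewrite -(card_in_imset FI); apply/subset_leq_card/subsetP => _ /imsetP[A _ ->].
by apply: block_subtree; lia.
Qed.

(** The sum is restricted to the subtrees without legs, of which there is one
    per interval; this loses little when there are few legs. *)
Lemma deficiency_ge :
  \sum_(ab in intervals) (#|G| - (ab.2.+1 - ab.1)) <= deficiency G.
Proof.
pose F ab := spanned (interval_block ab).
have FI : {in intervals &, injective F}.
  by move=> u v uI vI [e _]; exact: interval_block_inj.
rewrite (eq_bigr (fun ab => #|G| - #|(F ab).1|)) => [|[a b] _]; last first.
  by rewrite /F /= /interval_block card_block //=.
rewrite -(big_imset (fun H : {set G} * {set {set G}} =>
  #|G| - #|H.1|) FI) /=.
have sub H : (H \in F @: intervals) = (H \in subtrees G) && (H \in F @: intervals).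
  apply/idP/andP => [HF|[]//]; split=> //.
  case/imsetP: HF => -[a b]; rewrite inE /= => ab ->.
  by apply: block_subtree; rewrite ab ltn_ord.
rewrite (eq_bigl _ _ sub) /deficiency [leqRHS](bigID [in F @: intervals]) /=.
exact: leq_addr.
Qed.

End Spined.

(** * Sums over intervals *)

Section IntervalSums.
Local Open Scope nat_scope.

Lemma sum_intervals s (F : nat -> nat -> nat) :
  \sum_(ab in @intervals s) F ab.1 ab.2 = \sum_(b < s) \sum_(a < b.+1) F a b.
Proof.
under [RHS]eq_bigr => b _ do rewrite (big_ord_widen s (F^~ b) (ltn_ord b)).
rewrite (exchange_big_dep xpredT) //= pair_big_dep /=.
by apply: eq_bigl => -[a b]; rewrite inE /= ltnS.
Qed.

Lemma card_intervals s : 2 * #|@intervals s| = s * s.+1.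
Proof.
rewrite -sum1_card (sum_intervals s (fun _ _ => 1)).
elim: s => [|s IH]; first by rewrite big_ord0.
by rewrite big_ord_recr /= mulnDr IH sum_nat_const card_ord; lia.
Qed.

(** The mean length of an interval of 0, ..., s - 1 is (s + 2) / 3. *)
Lemma sum_interval_lengths s :
  3 * \sum_(ab in @intervals s) (ab.2.+1 - ab.1) = s.+2 * #|@intervals s|.
Proof.
apply/eqP; rewrite -(eqn_pmul2l (ltn0Sn 1)); apply/eqP.
rewrite [RHS]mulnCA card_intervals (sum_intervals s (fun a b => b.+1 - a)).
have len b : 2 * (\sum_(a < b.+1) (b.+1 - a)) = b.+1 * b.+2.
  elim: b => [|b IH]; first by rewrite big_ord_recl big_ord0.
  rewrite big_ord_recl mulnDr (eq_bigr (fun a : 'I_b.+1 => b.+1 - a)) // IH.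
  by rewrite subn0; nia.
elim: s => [|s IH]; first by rewrite big_ord0.
rewrite big_ord_recr /=; have := len s; move: IH.
by move: (\sum_(b < s) _) (\sum_(a < s.+1) _) => A B; nia.
Qed.

End IntervalSums.

(** * The competitor: a path with k legs at each end *)

Section DoubleBroom.
Local Open Scope nat_scope.
Context (r k : nat).

(** A path with r + 1 vertices and two bunches of k legs: the first hangs from
    vertex 0 of the path, the second from vertex r. *)
Definition broom_vertex : finType := ('I_r.+1 + ('I_k + 'I_k))%type.

Definition broom_pos (v : broom_vertex) : nat :=
  match v with inl i => i | inr (inl _) => 0 | inr (inr _) => r end.

Definition broom_adj (u v : broom_vertex) : bool :=
  match u, v with
  | inl i, inl j => (i.+1 == j :> nat) || (j.+1 == i :> nat)
  | inr _, inr _ => false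
  | _, _ => broom_pos u == broom_pos v
  end.

Lemma broom_adj_sym : symmetric broom_adj.
Proof. by move=> [i|l] [j|l'] //=; rewrite 1?orbC // eq_sym. Qed.

Lemma broom_adj_irrefl : irreflexive broom_adj.
Proof. by move=> [i|l] //=; lia. Qed.

Definition broom : sgraph :=
  @SGraph broom_vertex broom_adj broom_adj_sym broom_adj_irrefl.

Definition broom_spine : {set broom} := [set inl i | i : 'I_r.+1].

Lemma broom_spineE (v : broom) :
  (v \in broom_spine) = if v is inl _ then true else false.
Proof.
by case: v => [i|l]; [rewrite imset_f|apply/imsetP => -[]].
Qed.

Lemma card_broom : #|broom| = r.+1 + (k + k).
Proof. by rewrite card_sum card_sum !card_ord. Qed.

Lemma broom_spined : spined broom broom_spine broom_pos r.+1.
Proof.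
split.
- by move=> [i|[l|l]] /=.
- move=> [i|l] [j|l']; rewrite !broom_spineE // => _ _ /= e.
  by congr inl; apply: val_inj.
- by move=> i ir; exists (inl (Ordinal ir)); rewrite ?broom_spineE.
- by move=> [i|l] [j|l']; rewrite !broom_spineE.
Qed.

Lemma broom_is_tree : is_tree broom.
Proof.
split; first by rewrite card_broom.
  exact: spined_connected broom_spined.
exact: spined_acyclic broom_spined.
Qed.

Lemma broom_leavesE : 1 < k -> leaves broom = ~: broom_spine.
Proof.
move=> k2; apply/setP => x; rewrite !inE broom_spineE; case: x => [i|l] /=.
  rewrite gtn_eqF //.
  have k0 : 0 < k by lia.
  case: (eqVneq (i : nat) 0) => [i0|i0].
    by apply: (@degree_gt1 broom _ (inr (inl (Ordinal k0)))
      (inr (inl (Ordinal k2)))) => //=; rewrite i0.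
  case: (eqVneq (i : nat) r) => [ir|ir].
    by apply: (@degree_gt1 broom _ (inr (inr (Ordinal k0)))
      (inr (inr (Ordinal k2)))) => //=; rewrite ir.
  have i1 : i.-1 < r.+1 by have := ltn_ord i; lia.
  have i2 : i.+1 < r.+1 by have := ltn_ord i; lia.
  apply: (@degree_gt1 broom _ (inl (Ordinal i1)) (inl (Ordinal i2))) => /=.
  - by rewrite prednK ?eqxx ?orbT // lt0n.
  - by rewrite eqxx.
  - by rewrite eqE /=  -val_eqE /=; lia.
have lr : broom_pos (inr l) < r.+1 by case: l.
rewrite /degree (_ : [set y | _] = [set (inl (Ordinal lr) : broom)]) ?cards1 //.
apply/setP => -[j|l']; rewrite !inE //=.
apply/eqP/eqP => [e|[->] //]; congr inl; exact: val_inj.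
Qed.

Lemma broom_caterpillar : 1 < k -> is_caterpillar broom.
Proof.
move=> k2; split; first exact: broom_is_tree.
have coreP (i : 'I_r.+1) : (inl i : broom) \in ~: leaves broom.
  by rewrite broom_leavesE // setCK broom_spineE.
exists r.+1, (fun i => exist _ (inl i : broom) (coreP i)); split=> //.
exists (fun u => if val u is inl i then i else ord0) => //.
case=> [[i|l] p]; apply: val_inj => //=.
by exfalso; move: p; rewrite broom_leavesE // setCK broom_spineE.
Qed.

(** A subtree with legs at both ends contains the path between them. *)
Lemma broom_legs (H : {set broom} * {set {set broom}}) : H \in subtrees broom ->
  ~~ (broom_spine \subset H.1) ->
  H.1 :\: broom_spine \in
    powerset [set inr (inl i) | i : 'I_k] :|: powerset [set inr (inr i) | i : 'I_k].
Proof.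
move=> HT; apply: contraNT; rewrite in_setU !powersetE negb_or.
move=> /andP[/subsetPn[x + xl] /subsetPn[y + yl]].
rewrite !inE !broom_spineE.
case: x xl => [//|[x|x]] xl /= xH; first by rewrite imset_f in xl.
case: y yl => [//|[y|y]] yl /= yH; last by rewrite imset_f in yl.
apply/subsetP => z zS.
apply: (subtree_convex broom_spined HT yH xH) => //=.
by case: z zS => [i|l]; rewrite broom_spineE //= -ltnS ltn_ord.
Qed.

(** The subtrees that contain the spine miss at most 2k vertices each. The
    others are too few to add more than one per subtree on average. *)
Lemma broom_deficiency_le : 2 * #|broom| ^ 3 <= 2 ^ k ->
  deficiency broom <= (2 * k).+1 * #|subtrees broom|.
Proof.
move=> big_k; rewrite /deficiency.
pose whole H := broom_spine \subset (H : {set broom} * {set {set broom}}).1.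
rewrite (bigID whole) /= mulSn addnC.
have cS : #|broom_spine| = r.+1 := card_spine broom_spined (ltn0Sn r).
have N_ge : 4 ^ k <= #|subtrees broom|.
  have := card_subtrees_ge broom_spined (ltn0Sn r).
  by rewrite cardsCs setCK cS card_broom addKn addnn -mul2n expnM.
apply: leq_add; last first.
  rewrite mulnC -sum_nat_const [leqRHS](bigID whole) /=.
  apply: leq_trans (leq_addr _ _); apply: leq_sum => H /andP[_ /subset_leq_card].
  by rewrite cS card_broom => rH; rewrite leq_subLR addnn -mul2n leq_add2r.
apply: leq_trans N_ge.
pose P := [set H in subtrees broom | ~~ whole H].
pose Q := powerset [set (inr (inl i) : broom) | i : 'I_k]
  :|: powerset [set (inr (inr i) : broom) | i : 'I_k].
have cP : #|P| <= #|@intervals r.+1|.+1 * #|Q|.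
  apply: (card_subtrees_le broom_spined).
    by apply/subsetP => H; rewrite inE => /andP[].
  by move=> H; rewrite inE => /andP[HT]; exact: broom_legs.
have cQ : #|Q| <= 2 * 2 ^ k.
  apply: leq_trans (leq_card_setU _ _) _.
  rewrite !card_powerset mul2n -addnn.
  by apply: leq_add; apply: leq_pexp2l => //;
    apply: leq_trans (leq_imset_card _ _) _; rewrite card_ord.
have cI : #|@intervals r.+1|.+1 <= #|broom| ^ 2.
  have k0 : 0 < k by case: (k) big_k => //; rewrite card_broom expnS; nia.
  by have := card_intervals r.+1; rewrite card_broom; nia.
apply: (@leq_trans (\sum_(H in P) #|broom|)).
  rewrite [leqRHS](eq_bigl (fun H => (H \in subtrees broom) && ~~ whole H)).
    by apply: leq_sum => H _; exact: leq_subr.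
  by move=> H; rewrite inE.
rewrite sum_nat_const.
have -> : 4 ^ k = 2 ^ k * 2 ^ k by rewrite -expnMn.
apply: (@leq_trans (2 * #|broom| ^ 3 * 2 ^ k)); last by rewrite leq_mul2r big_k orbT.
have -> : 2 * #|broom| ^ 3 * 2 ^ k = #|broom| ^ 2 * (2 * 2 ^ k) * #|broom| by lia.
rewrite leq_mul2r; apply/orP; right; apply: leq_trans cP _.
exact: leq_mul.
Qed.

End DoubleBroom.

(** * The spine of a caterpillar *)

Section CaterpillarSpine.
Local Open Scope nat_scope.
Context {G : sgraph}.
Implicit Types x y z : G.

(** The isomorphism with a path, turned into a coordinate on the whole vertex
    type to avoid working in the subtype of an induced subgraph. *)
Lemma path_index {C : {set G}} : is_path (induced C) ->
  exists m (idx : G -> nat),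
  [/\ {in C, forall x, idx x < m}, {in C &, injective idx},
      forall i, i < m -> exists2 x, x \in C & idx x = i &
      {in C &, forall x y,
         adj x y = ((idx x).+1 == idx y) || ((idx y).+1 == idx x)}].
Proof.
case=> m [f [[g fK gK] fadj]].
pose idx x : nat := if insub x is Some u then g u else 0.
have idxE x (xC : x \in C) : idx x = g (exist _ x xC) by rewrite /idx insubT.
exists m, idx; split.
- by move=> x xC; rewrite idxE.
- move=> x y xC yC; rewrite !idxE => /val_inj/(can_inj gK) e.
  exact: (congr1 (fun u : induced C => sval u) e).
- move=> i im; exists (val (f (Ordinal im))); first exact: valP.
  rewrite (idxE _ (valP _)) (_ : exist _ _ _ = f (Ordinal im)) ?fK //.
  exact: val_inj.
- by move=> x y xC yC; rewrite !idxE -fadj !gK.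
Qed.

Definition support x : G := odflt x [pick y | adj x y].

Lemma leaf_adj x y : x \in leaves G -> adj x y = (y == support x).
Proof.
rewrite inE => /cards1P[w xw].
have xE z : adj x z = (z == w) by move/setP: xw => /(_ z); rewrite !inE.
rewrite xE /support; case: pickP => [u|/(_ w)]; rewrite xE ?eqxx //.
by move=> /eqP ->.
Qed.

Hypothesis conG : connected_graph G.

(** Two adjacent leaves would form a connected component of order 2. *)
Lemma support_core x : 2 < #|G| -> x \in leaves G -> support x \in ~: leaves G.
Proof.
move=> G3 xl; rewrite inE; apply/negP => yl; set y := support x in yl.
have xy : adj x y by rewrite leaf_adj.
have yx : x == support y by rewrite -leaf_adj // adj_sym.
have cl : closed (@adj G) [set x; y].
  apply: intro_closed; first by apply: sym_connect_sym => u v; rewrite adj_sym.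
  move=> u v uv; rewrite !inE => /orP[]/eqP ue; move: uv; rewrite ue leaf_adj //.
    by rewrite -/y => ->; rewrite orbT.
  by rewrite -(eqP yx) => ->.
suff : #|G| <= #|[set x; y]| by rewrite cards2; case: (_ != _); lia.
apply/subset_leq_card/subsetP => z _.
by rewrite -(closed_connect cl (conG x z)) set21.
Qed.

(** A non-leaf has degree at least 1 by connectedness, hence at least 2. *)
Lemma core_neighbour x c : 1 < #|G| -> x \in ~: leaves G ->
  exists2 y, adj x y & y != c.
Proof.
move=> G2; rewrite !inE /degree => deg1.
have [z zx] : exists z, z != x.
  by move: G2; rewrite (cardD1 x) ltnS => /card_gt0P[z /andP[]]; exists z.
have deg0 : 0 < #|[set y | adj x y]|.
  have /connectP[[|w p] /= pth e] := conG x z; first by rewrite e eqxx in zx.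
  by apply/card_gt0P; exists w; rewrite inE; case/andP: pth.
have : 0 < #|[set y | adj x y] :\ c|.
  by move: deg1 deg0; rewrite (cardsD1 c); case: (_ \in _); lia.
by case/card_gt0P => y; rewrite !inE => /andP[yc xy]; exists y.
Qed.

(** An end of the path of non-leaves has at most one neighbour on this path,
    and at least two in all, so some leaf hangs from it. A leaf x0 at the first
    end and another leaf x1 at the last end prolong the path to the spine; x0
    gets coordinate 0, x1 the last one, and the others shift by one. *)
Lemma caterpillar_spined : 2 < #|G| -> is_path (induced (~: leaves G)) ->
  exists (spine : {set G}) pos s,
    [/\ spined G spine pos s, 2 < s & #|leaves G| + s = #|G| + 2].
Proof.
move=> G3 /path_index[m [idx [idx_lt idx_inj idx_surj idx_adj]]].
set C := ~: leaves G in idx_lt idx_inj idx_surj idx_adj.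
have notC x : x \notin C -> x \in leaves G by rewrite inE negbK.
have sC x : x \notin C -> support x \in C by move=> /notC; exact: support_core.
have adjC x y : x \notin C -> adj x y = (y == support x).
  by move=> /notC; exact: leaf_adj.
have m0 : 0 < m.
  have /card_gt0P[x _] : 0 < #|G| by lia.
  case: (boolP (x \in C)) => [/idx_lt|/sC/idx_lt]; lia.
have [p0 p0C p0i] := idx_surj 0 m0.
have [p1 p1C p1i] : exists2 x, x \in C & idx x = m.-1 by apply: idx_surj; lia.
have [x0 x0C x0s] : exists2 x, x \notin C & support x = p0.
  (* c is the only neighbour of p0 on the path, if there is one *)
  have [c cC] : exists c, forall y, y \in C -> adj p0 y -> y = c.
    case: (ltnP 1 m) => [/idx_surj[c cC ci]|m1].
      exists c => y yC; rewrite idx_adj // p0i => h.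
      by apply: idx_inj => //; rewrite ci; lia.
    exists p0 => y yC; rewrite idx_adj // p0i.
    by have := idx_lt _ yC; lia.
  have [x p0x xc] := core_neighbour p0 c (ltnW G3) p0C.
  have xC : x \notin C by apply: contraNN xc => xC; rewrite (cC x).
  by exists x => //; apply/esym/eqP; rewrite -adjC // adj_sym.
have [x1 [x1C x1s x10]] : exists x, [/\ x \notin C, support x = p1 & x != x0].
  (* when the path is a single vertex, its two leaves must differ, and it is x0
     that has to be avoided; otherwise x0 is not adjacent to p1 *)
  have [c cC] : exists c, forall y, y \in C :|: [set x0] -> adj p1 y -> y = c.
    case: (ltnP 1 m) => [m1|m1].
      have [c cC ci] : exists2 x, x \in C & idx x = m.-2 by apply: idx_surj; lia.
      exists c => y; rewrite in_setU in_set1 => /orP[yC|/eqP ->].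
        rewrite idx_adj // p1i => h; apply: idx_inj => //.
        by have := idx_lt y yC; rewrite ci; lia.
      rewrite adj_sym adjC // x0s => /eqP e.
      by move: p0i; rewrite -e p1i; lia.
    exists x0 => y; rewrite in_setU in_set1 => /orP[yC|/eqP -> //].
    rewrite idx_adj // p1i.
    by have := idx_lt y yC; lia.
  have [x p1x xc] := core_neighbour p1 c (ltnW G3) p1C.
  have : x \notin C :|: [set x0] by apply: contraNN xc => xC; rewrite (cC x).
  rewrite in_setU negb_or in_set1 => /andP[xC xx0].
  by exists x; split=> //; apply/esym/eqP; rewrite -adjC // adj_sym.
pose spine := x0 |: (x1 |: C).
pose foot x := if x \in C then x else support x.
pose pos x := if x == x0 then 0 else if x == x1 then m.+1 else (idx (foot x)).+1.
have footC x : foot x \in C by rewrite /foot; case: ifPn => // /sC.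
have pos0 : pos x0 = 0 by rewrite /pos eqxx.
have pos1 : pos x1 = m.+1 by rewrite /pos (negPf x10) eqxx.
have posP x : [\/ x = x0, x = x1 |
    [/\ x != x0, x != x1 & pos x = (idx (foot x)).+1]].
  rewrite /pos; case: (eqVneq x x0) => [|xx0]; first by constructor 1.
  by case: (eqVneq x x1) => [|xx1]; [constructor 2|constructor 3].
have posC x : x \in C -> pos x = (idx x).+1.
  case: (posP x) => [->|->|[_ _ ->]]; rewrite ?(negPf x0C) ?(negPf x1C) //.
  by rewrite /foot => ->.
have posl x : x \notin spine -> pos x = (idx (support x)).+1.
  rewrite !in_setU1 !negb_or.
  case: (posP x) => [->|->|[_ _ ->]]; rewrite ?eqxx ?andbF //.
  by case/and3P => _ _ xC; rewrite /foot (negPf xC).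
have spineP x : x \in spine -> [\/ x = x0, x = x1 | x \in C].
  rewrite !in_setU1 => /or3P[/eqP|/eqP|];
    [by constructor 1|by constructor 2|by constructor 3].
have x0S : x0 \in spine by rewrite !in_setU1 eqxx.
have x1S : x1 \in spine by rewrite !in_setU1 eqxx orbT.
have CS x : x \in C -> x \in spine by move=> xC; rewrite !in_setU1 xC !orbT.
have sp : spined G spine pos m.+2.
  split.
  - move=> x; case: (posP x) => [->|->|[_ _ ->]]; rewrite ?pos0 ?pos1 //.
    by have := idx_lt _ (footC x); lia.
  - move=> x y /spineP[->|->|xC] /spineP[->|->|yC] //;
      rewrite ?pos0 ?pos1 ?(posC x) ?(posC y) //.
    + by have := idx_lt _ yC; lia.
    + by have := idx_lt _ xC; lia.
    + by case=> /idx_inj; exact.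
  - case=> [|i] im; first by exists x0.
    case: (eqVneq i m) => [->|i_m]; first by exists x1.
    have [x xC xi] : exists2 x, x \in C & idx x = i by apply: idx_surj; lia.
    by exists x; rewrite ?CS // posC // xi.
  - pose A x y := if x \in spine then
      if y \in spine then ((pos x).+1 == pos y) || ((pos y).+1 == pos x)
      else pos x == pos y
    else (y \in spine) && (pos x == pos y).
    have idxE x y : x \in C -> y \in C -> (idx x == idx y) = (x == y).
      by move=> xC yC; apply/eqP/eqP => [/idx_inj|->] //; exact.
    have A_sym x y : A x y = A y x.
      by rewrite /A; case: (x \in spine); case: (y \in spine);
        rewrite 1?orbC // eq_sym.
    have AC x y : x \in C -> y \in C -> adj x y = A x y.
      by move=> xC yC; rewrite /A !CS // idx_adj // !posC.
    have Al x y : x \notin C -> adj x y = A x y.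
      move=> xC; rewrite adjC //.
      have ysup : (y == support x) = (y \in C) && (idx y == idx (support x)).
        case: (boolP (y \in C)) => yC /=; first by rewrite idxE ?sC.
        by apply: contraNF yC => /eqP ->; exact: sC.
      rewrite ysup /A; case: (boolP (x \in spine)) => [/spineP[xe|xe|]|xS].
      + rewrite xe pos0 x0s p0i.
        case: (boolP (y \in spine)) => [/spineP[->|->|yC]|yS].
        * by rewrite pos0 (negPf x0C).
        * by rewrite pos1 (negPf x1C) /=; clear -m0; lia.
        * by rewrite yC posC //; clear -m0; lia.
        * by rewrite posl // (contraNF (CS y)).
      + rewrite xe pos1 x1s p1i.
        case: (boolP (y \in spine)) => [/spineP[->|->|yC]|yS].
        * by rewrite pos0 (negPf x0C) /=; clear -m0; lia.
        * by rewrite pos1 (negPf x1C) /=; clear -m0; lia.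
        * by rewrite yC posC //; have := idx_lt _ yC; clear -m0; lia.
        * rewrite posl // (contraNF (CS y)) //.
          have yC : y \notin C by apply: contraNN yS => /CS.
          by have := idx_lt _ (sC _ yC); clear -m0; lia.
      + by rewrite (negPf xC).
      + rewrite (posl x) // ; have xlt := idx_lt _ (sC _ xC).
        case: (boolP (y \in spine)) => [/spineP[->|->|yC]|yS].
        * by rewrite pos0 (negPf x0C).
        * by rewrite pos1 (negPf x1C) /=; clear -m0 xlt; lia.
        * by rewrite yC posC // eqSS eq_sym.
        * by rewrite (contraNF (CS y)).
    move=> x y; case: (boolP (x \in C)) => xC; last exact: Al.
    case: (boolP (y \in C)) => yC; first exact: AC.
    by rewrite adj_sym Al // A_sym.
exists spine, pos, m.+2; split=> //.
rewrite -(card_spine sp) // !cardsU1 !inE eq_sym (negPf x10) /=.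
have := cardsC (leaves G); rewrite -/C.
move: x0C x1C; rewrite !inE !negbK => -> -> /=; lia.
Qed.

End CaterpillarSpine.

(** * The deficiency of a caterpillar with few leaves *)

Section Bounds.
Local Open Scope nat_scope.
Context {G : sgraph}.

(** With n the order of G and P the number of intervals, at least
    P (3n - s - 2) / 3 vertices are missed by the at most (P + 1) 2^(n - s)
    subtrees. The former number is at least P (2n - 2) / 3, as s <= n; and
    6 <= L gives 14 (6L + 9) <= 90 (L + 1), so that the numerical hypothesis
    bounds 6L + 9 times the latter by (15/28) n (P + 1). *)
Lemma spined_deficiency_gt {spine : {set G}} {pos : G -> nat} {s : nat} L :
  spined G spine pos s -> 2 < s -> 6 <= L ->
  12 * 2 ^ (#|G| - s) * L.+1 <= #|G| ->
  (2 * (3 * L + 4)).+1 * #|subtrees G| < deficiency G.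
Proof.
move=> sp s3 L6 bigG.
have cS : #|spine| = s by apply: card_spine sp _; lia.
have sG : s <= #|G| by rewrite -cS max_card.
set P := #|@intervals s|.
have P2 : 2 * P = s * s.+1 := card_intervals s.
have N_le : #|subtrees G| <= P.+1 * 2 ^ (#|G| - s).
  have -> : #|G| - s = #|~: spine| by rewrite cardsCs setCK cS.
  rewrite -card_powerset; apply: (card_subtrees_le sp) => // H _.
  by rewrite powersetE; apply/subsetP => x; rewrite !inE => /andP[].
have len := sum_interval_lengths s.
have d_ge : #|G| * P - \sum_(ab in @intervals s) (ab.2.+1 - ab.1) <= deficiency G.
  apply: leq_trans (deficiency_ge sp).
  rewrite leq_subLR -big_split /= mulnC -sum_nat_const.
  by apply: leq_sum => ab _; lia.
move: len d_ge; set Q := (\sum_(ab in _) _); rewrite -/P => len d_ge.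
move: bigG N_le d_ge sG.
set W := 2 ^ _; set N := #|subtrees G|; set d := deficiency G; set n := #|G|.
move=> bigG N_le d_ge sG.
have W0 : 0 < W by rewrite expn_gt0.
(* W is the number of sets of legs, N and d the number of subtrees of G and its
   deficiency, n its order *)
have n84 : 84 <= n.
  by apply: leq_trans bigG; apply: (@leq_mul 12 7); rewrite ?leq_pmulr.
have P6 : 6 <= P.
  by rewrite -(leq_pmul2l (isT : 0 < 2)) P2; apply: (@leq_mul 3 4).
have d3 : P * (2 * n) <= 3 * d + 2 * P.
  have : s.+2 * P <= n.+2 * P by rewrite leq_mul2r !ltnS sG orbT.
  by move: len d_ge; clear; lia.
have K_W : 28 * (6 * L + 9) * W <= 15 * n.
  have : 14 * (6 * L + 9) * W <= 90 * L.+1 * W by rewrite leq_mul2r; lia.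
  by move: bigG; clear; lia.
have K_N : 28 * (6 * L + 9) * N <= 15 * n * P.+1.
  apply: leq_trans (leq_mul (leqnn _) N_le) _.
  by rewrite (mulnC P.+1) mulnA leq_mul2r K_W orbT.
have nP84 : 84 * P <= n * P by rewrite leq_mul2r n84 orbT.
have nP6 : n * 6 <= n * P by rewrite leq_mul2l P6 orbT.
have -> : (2 * (3 * L + 4)).+1 = 6 * L + 9 by lia.
rewrite -(ltn_pmul2l (isT : 0 < 28)) mulnA.
by move: K_N d3 nP84 nP6 P6; clear; lia.
Qed.

End Bounds.

(** * Comparison *)

(** The constants leave room for rounding the logarithm down to L. *)
Lemma better_caterpillar (T : sgraph) (L : nat) :
  is_caterpillar T -> (2 <= #|T|)%N -> (2 ^ L <= #|T| < 2 ^ L.+1)%N ->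
  (3 * 2 ^ #|leaves T| * L.+1 <= #|T|)%N ->
  exists T' : sgraph,
    [/\ is_caterpillar T', #|T'| = #|T| &
      mean_subtree_order T < mean_subtree_order T'].
Proof.
move=> [[T0 conT _] pathT] T2 /andP[L_le L_lt] big.
have L1 : (1 <= L)%N by case: (L) L_lt => // /(leq_trans T2).
have l0 : (1 <= 2 ^ #|leaves T|)%N by rewrite expn_gt0.
have T3 : (2 < #|T|)%N by nia.
have [spine [pos [s [sp s3 ls]]]] := caterpillar_spined conT T3 pathT.
have sT : (s <= #|T|)%N.
  by rewrite -(card_spine sp) ?max_card //; lia.
have {}big : (12 * 2 ^ (#|T| - s) * L.+1 <= #|T|)%N.
  have e : #|leaves T| = (#|T| - s).+2 by lia.
  by move: big; rewrite e !expnS; lia.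
have W0 : (1 <= 2 ^ (#|T| - s))%N by rewrite expn_gt0.
have L12 : (12 * L.+1 <= #|T|)%N by nia.
(* 12 (L + 1) < 2 ^ (L + 1) fails for L < 6 *)
have L6 : (6 <= L)%N.
  rewrite leqNgt; apply/negP => L5.
  have := leq_ltn_trans L12 L_lt.
  by move: L L5 {L1 L_le L_lt big L12}; do 6 case=> //.
(* k is the least exponent with 2 * (2 ^ L.+1) ^ 3 <= 2 ^ k; the path gets the
   vertices that the 2k legs leave *)
pose k := (3 * L + 4)%N; pose r := (#|T| - (k + k)).-1.
have cB : #|broom r k| = #|T| by rewrite card_broom /r /k; lia.
exists (broom r k); split=> //; first by apply: broom_caterpillar; rewrite /k; lia.
apply: (@mean_lt _ _ (2 * k).+1) => //.
  exact: (spined_deficiency_gt _ sp).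
apply: broom_deficiency_le; rewrite cB.
rewrite /k (_ : 3 * L + 4 = (L.+1 * 3).+1)%N; last by lia.
by rewrite (expnS 2) leq_mul2l /= expnM leq_exp2r // ltnW.
Qed.

Theorem corollary6p4 (R : realType) (T : sgraph) (n : nat)
  (n_ge2 : (2 <= n)%N) (caterpillarT : is_caterpillar T) (orderT : #|T| = n) :
  let N : R := n%:R in
  log2 (N / (3 * log2 N + 3)) = log2 N - log2 (log2 N + 1) - log2 3 /\
  ((#|leaves T|)%:R <= log2 (N / (3 * log2 N + 3)) ->
   ~ optimal (trees_of_order n) T /\ ~ optimal (caterpillars_of_order n) T).
Proof.
move=> N.
have ln2 : 0 < ln (2 : R) by rewrite ln_gt0 // ltr1n.
have N0 : 0 < N by rewrite ltr0n; lia.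
have log2X m : log2 ((2 ^ m)%:R : R) = m%:R.
  by rewrite /log2 natrX lnXn ?ltr0n // -[ln _ *+ _]mulr_natl mulfK // gt_eqF.
have pow0 m : 0 < (2 ^ m)%:R :> R by rewrite ltr0n expn_gt0.
have log2_le (x y : R) : 0 < x -> 0 < y -> (log2 x <= log2 y) = (x <= y).
  by move=> x0 y0; rewrite /log2 ler_pM2r ?invr_gt0 // ler_ln.
have /andP[L_le L_lt] := trunc_log_bounds (isT : (1 < 2)%N) (ltnW n_ge2).
set L := trunc_log 2 n in L_le L_lt.
have logN : L%:R <= log2 N.
  by rewrite -log2X log2_le // ler_nat.
have logN1 : 0 < log2 N + 1 by apply: ltr_wpDl => //; exact: le_trans logN.
have -> : 3 * log2 N + 3 = 3 * (log2 N + 1) by rewrite mulrDr mulr1.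
split.
  move: (log2 N + 1) logN1 => a a0.
  rewrite /log2 lnM ?posrE ?invr_gt0 ?mulr_gt0 // lnV ?posrE ?mulr_gt0 //.
  by rewrite lnM ?posrE // -!mulrBl; congr (_ / _); lra.
have den0 : 0 < 3 * (log2 N + 1) by rewrite mulr_gt0.
rewrite -(log2X #|leaves T|) log2_le ?divr_gt0 // ler_pdivlMr // => big.
have bigL : (3 * 2 ^ #|leaves T| * L.+1 <= #|T|)%N.
  rewrite orderT -(ler_nat R); apply: le_trans big.
  rewrite !natrM mulrAC mulrC !mulrA ler_pM2l ?mulr_gt0 //.
  by rewrite -natr1 lerD2r.
have [T' [catT' cT' lt]] : exists T' : sgraph, [/\ is_caterpillar T', #|T'| = #|T| &
    mean_subtree_order T < mean_subtree_order T'].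
  apply: (@better_caterpillar _ L) => //; rewrite orderT //.
  by rewrite L_le.
rewrite orderT in cT'.
have refute (family : sgraph -> Prop) : family T' -> ~ optimal family T.
  by move=> famT' [_ /(_ T' famT')]; rewrite leNgt lt.
by split; apply: refute; split=> //; case: catT'.
Qed.
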